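(* Let $X$ be a metrizable uniform space. (1) $X$ is a uniform AR if and only if $X$ is homotopy complete and its completion is an ARU. (2) $X$ is a uniform ANR if and only if $X$ is homotopy complete and its completion is an ANRU.
   Context: A uniform neighborhood of a subset $S$ of a uniform space $Z$ is a subset of $Z$ containing the star of $S$ in some uniform cover of $Z$ (in the metric case: containing an $\varepsilon$-neighborhood of $S$ for some $\varepsilon>0$). A uniform AR [uniform ANR] is a metrizable uniform space $Y$ such that for every uniform embedding $i$ of $Y$ onto a closed subspace of a metrizable uniform space $Z$ there exists a uniformly continuous retraction of $Z$ [respectively, of some uniform neighborhood of $i(Y)$ in $Z$] onto $i(Y)$. An ARU [ANRU] is a uniform space $Y$ such that for every uniform embedding $i$ of $Y$ (onto a not necessarily closed subspace) into a (not necessarily metrizable) uniform space $Z$ there exists a uniformly continuous retraction of $Z$ [respectively, of some uniform neighborhood of $i(Y)$ in $Z$] onto $i(Y)$. Uniform spaces are assumed separated (Hausdorff). A uniform space $X$ with completion $\bar X$ is homotopy complete if there exists a uniformly continuous map $H\colon\bar X\times[0,1]\to\bar X$ such that $H(x,0)=x$ for all $x\in\bar X$ and $H(\bar X\times(0,1])\subset X$. *)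

(* Defs.v *)
From HB Require Import structures.
From mathcomp Require Import all_boot all_order all_algebra.
From mathcomp Require Import all_classical all_reals topology.

Set Implicit Arguments.
Unset Strict Implicit.
Unset Printing Implicit Defensive.

Import Order.TTheory GRing.Theory Num.Theory.
Import numFieldTopology.Exports.

Local Open Scope classical_set_scope.
Local Open Scope ring_scope.

Section MetrizableSpaces.
Variable R : realType.

(* The conditions on [d] are those of the library factory [isMetric]; the last
   clause says that [d] induces the given uniformity. *)
Definition metrizable (Y : uniformType) : Prop :=
  exists d : Y -> Y -> R,
    [/\ forall x, d x x = 0,
        forall x y, d x y = 0 -> x = y,
        forall x y, d x y = d y x,
        forall y x z, d x z <= d x y + d y z
      & @entourage Y = entourage_ (fun x e => [set y | d x y < e])].

End MetrizableSpaces.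

Section UniformNeighborhoods.
Variable Z : uniformType.

Definition uniform_cover (U : set (set Z)) : Prop :=
  exists2 E : set (Z * Z), entourage E &
    forall z, exists2 A, U A & xsection E z `<=` A.

Definition star (S : set Z) (U : set (set Z)) : set Z :=
  \bigcup_(A in [set A | U A /\ A `&` S !=set0]) A.

Definition uniform_nbhd (S N : set Z) : Prop :=
  exists2 U, uniform_cover U & star S U `<=` N.

(* A set used as a type is the subspace it carries. *)
Definition uniform_retract (A N : set Z) : Prop :=
  A `<=` N /\
  exists r : N -> A, unif_continuous r /\
    forall x : N, A (\val x) -> \val (r x) = \val x.

End UniformNeighborhoods.

(* A uniform isomorphism onto the subspace [range i]. *)
Definition uniform_embedding (Y Z : uniformType) (i : Y -> Z) : Prop :=
  [/\ injective i, unif_continuous i &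
      exists2 g : range i -> Y, unif_continuous g &
        forall z : range i, i (g z) = \val z].

Section UniformRetracts.
Variable R : realType.

Definition uniform_AR (Y : uniformType) : Prop :=
  metrizable R Y /\
  forall (Z : uniformType) (i : Y -> Z),
    metrizable R Z -> uniform_embedding i -> closed (range i) ->
    uniform_retract (range i) setT.

Definition uniform_ANR (Y : uniformType) : Prop :=
  metrizable R Y /\
  forall (Z : uniformType) (i : Y -> Z),
    metrizable R Z -> uniform_embedding i -> closed (range i) ->
    exists2 N, uniform_nbhd (range i) N & uniform_retract (range i) N.

End UniformRetracts.

Definition ARU (Y : uniformType) : Prop :=
  hausdorff_space Y /\
  forall (Z : uniformType) (i : Y -> Z),
    hausdorff_space Z -> uniform_embedding i ->
    uniform_retract (range i) setT.

Definition ANRU (Y : uniformType) : Prop :=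
  hausdorff_space Y /\
  forall (Z : uniformType) (i : Y -> Z),
    hausdorff_space Z -> uniform_embedding i ->
    exists2 N, uniform_nbhd (range i) N & uniform_retract (range i) N.

(* The axiom of [completeType], which cannot be used directly here because it
   excludes the empty space. *)
Definition complete_space (Y : uniformType) : Prop :=
  forall F : set_system Y, ProperFilter F -> cauchy F ->
    exists y : Y, F --> y.

(* The completion is determined only up to uniform isomorphism; [completion]
   recognizes the canonical maps [j : X -> Xb] into it. *)
Definition completion (X Xb : uniformType) (j : X -> Xb) : Prop :=
  [/\ hausdorff_space Xb, complete_space Xb,
      uniform_embedding j & dense (range j)].

Definition homotopy_complete (R : realType) (X Xb : uniformType)
    (j : X -> Xb) : Prop :=
  exists H : (Xb * `[0%R, 1%R : R]%classic)%type -> Xb,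
    [/\ unif_continuous H,
        forall x t, \val t = 0 -> H (x, t) = x
      & forall x t, 0 < \val t -> range j (H (x, t))].

Lemma metrizable_hausdorff (R : realType) (Y : uniformType) :
  metrizable R Y -> hausdorff_space Y.
Proof.
move=> [d [dxx d0 dC dT entE]] x y xy.
have d_ge0 u v : 0 <= d u v.
  by have := dT v u u; rewrite dxx (dC v u) -mulr2n pmulrn_lge0.
apply: d0; apply/eqP; rewrite eq_le d_ge0 andbT; apply/ler_addgt0Pl => e e0.
have e20 : 0 < e / 2 by rewrite divr_gt0.
have entB : @entourage Y [set uv | d uv.1 uv.2 < e / 2].
  by rewrite entE; exists (e / 2).
have [z [/xsectionP xz /xsectionP yz]] :=
  xy _ _ (nbhs_entourage x entB) (nbhs_entourage y entB).
rewrite addr0 (le_trans (dT z x y))// (dC z y) (splitr e).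
by rewrite lerD// ltW.
Qed.

(* Existence of completions: the points of the completion are the minimal
   (equivalently, round) Cauchy filters. *)
Section CompletionExists.
Variable X : uniformType.

Record round_filter := RoundFilter {
  rf_sets : set_system X;
  rf_proper : ProperFilter rf_sets;
  rf_cauchy : forall E, entourage E ->
    exists2 A, rf_sets A & forall x y, A x -> A y -> E (x, y);
  rf_round : forall A, rf_sets A -> exists2 B, rf_sets B &
    exists2 E, entourage E & forall x y, B x -> E (x, y) -> A y
}.

#[local] Existing Instance rf_proper.

HB.instance Definition _ := gen_eqMixin round_filter.
HB.instance Definition _ := gen_choiceMixin round_filter.

Definition rf_near (E : set (X * X)) : set (round_filter * round_filter) :=
  [set FG | exists A B, [/\ rf_sets FG.1 A, rf_sets FG.2 B &
    forall x y, A x -> B y -> E (x, y)]].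

Definition rf_ent : set_system (round_filter * round_filter) :=
  filter_from entourage rf_near.

Let rf_filter : Filter rf_ent.
Proof.
apply: filter_from_filter; first by exists setT; exact: entourageT.
move=> E D entE entD; exists (E `&` D); first exact: filterI.
by move=> [F G] [A [B [FA GB AB]]]; split; exists A, B; split=> // x y Ax By;
  have [] := AB x y Ax By.
Qed.

Let rf_diag A : rf_ent A -> diagonal `<=` A.
Proof.
move=> [E entE EA] [F G] /diagonalP <-; apply: EA.
by have [B FB BE] := rf_cauchy F entE; exists B, B.
Qed.

Let rf_inv A : rf_ent A -> rf_ent (A^-1)%relation.
Proof.
move=> [E entE EA]; exists (E^-1)%relation; first exact: entourage_inv.
move=> [F G] [A' [B [FA GB AB]]]; apply: EA; exists B, A'.
by split=> // x y Bx Ay; exact: AB Ay Bx.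
Qed.

Let rf_split A : rf_ent A -> exists2 B, rf_ent B & (B \; B `<=` A)%relation.
Proof.
move=> [E entE EA]; exists (rf_near (split_ent E)); first by exists (split_ent E).
move=> [F G] [K [A1 [B1 [FA1 KB1 AB1]]] [A2 [B2 [KA2 GB2 AB2]]]]; apply: EA.
exists A1, B2; split=> // x y Ax By.
have [z [B1z A2z]] := filter_ex (filterI KB1 KA2).
exact: (entourage_split z entE (AB1 _ _ Ax B1z) (AB2 _ _ A2z By)).
Qed.

HB.instance Definition _ := isUniform.Build round_filter
  rf_filter rf_diag rf_inv rf_split.

Let ent_pow4 (E : set (X * X)) : entourage E -> exists2 D, entourage D &
  (forall x y, D (x, y) -> D (y, x)) /\
  (forall a b c d e, D (a, b) -> D (b, c) -> D (c, d) -> D (d, e) -> E (a, e)).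
Proof.
move=> entE; pose D := split_ent (split_ent E).
have entD : entourage D by apply: entourage_split_ent; exact: entourage_split_ent.
exists (D `&` D^-1)%relation; first exact: entourage_invI.
split=> [x y [] //|a b c d e [ab _] [bc _] [cd _] [de _]].
apply: (entourage_split c) => //.
- by apply: (entourage_split b) => //; exact: entourage_split_ent.
- by apply: (entourage_split d) => //; exact: entourage_split_ent.
Qed.

Let nbhs_cauchy (x : X) E : entourage E ->
  exists2 A, nbhs x A & forall y z, A y -> A z -> E (y, z).
Proof.
move=> /ent_pow4[D entD [Dsym D4]]; exists (xsection D x).
  exact: nbhs_entourage.
move=> y z /xsectionP xy /xsectionP xz.
apply: (D4 _ x z z) => //; [exact: Dsym|exact: entourage_refl..].
Qed.

Let nbhs_round (x : X) A : nbhs x A -> exists2 B, nbhs x B &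
  exists2 E, entourage E & forall y z, B y -> E (y, z) -> A z.
Proof.
move=> /nbhsP[E entE EA].
exists (xsection (split_ent E) x); first exact: nbhs_entourage.
exists (split_ent E) => // y z /xsectionP xy yz; apply/EA/xsectionP.
exact: (entourage_split y).
Qed.

Definition rf_nbhs (x : X) : round_filter :=
  RoundFilter (nbhs_pfilter x) (nbhs_cauchy x) (@nbhs_round x).

Let rf_le (F G : round_filter) :
  (forall E, entourage E -> rf_near E (F, G)) -> rf_sets F `<=` rf_sets G.
Proof.
move=> FG A /rf_round[B FB [E entE BE]].
have [A' [B' [FA' GB' AB]]] := FG E entE.
have [b [Bb A'b]] := filter_ex (filterI FB FA').
by apply: filterS GB' => y B'y; apply: BE Bb _; exact: AB.
Qed.

Let rf_eq (F G : round_filter) : rf_sets F = rf_sets G -> F = G.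
Proof.
case: F G => [F pF cF rF] [G pG cG rG] /= FG; rewrite -{}FG in pG cG rG *.
by congr RoundFilter; exact: Prop_irrelevance.
Qed.

Let rf_hausdorff : hausdorff_space round_filter.
Proof.
move=> F G FG; suff near E : entourage E -> rf_near E (F, G).
  apply/rf_eq/seteqP; split; apply: rf_le => // E entE.
  have [A [B [FA GB AB]]] := near _ (entourage_inv entE).
  by exists B, A; split=> // x y Bx Ay; exact: AB Ay Bx.
move=> /ent_pow4[D entD [Dsym D4]].
have entD' : entourage (rf_near D) by exists D.
have [K [/xsectionP FK /xsectionP GK]] :=
  FG _ _ (nbhs_entourage F entD') (nbhs_entourage G entD').
have [A [B [FA KB AB]]] := FK.
have [A' [B' [GA' KB' AB']]] := GK.
have [z [Bz B'z]] := filter_ex (filterI KB KB').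
exists A, A'; split=> // x y Ax A'y.
by apply: (D4 _ z y y); [exact: AB|apply: Dsym; exact: AB'|exact: entourage_refl..].
Qed.

Let rf_complete : complete_space round_filter.
Proof.
move=> P PP cP.
have small E : entourage E -> exists2 A : set X,
    (forall x y, A x -> A y -> E (x, y)) &
    forall D, entourage D -> (E `<=` D) ->
      \forall G \near P, exists2 B, rf_sets G B &
        forall b, B b -> exists2 a, A a & D (a, b).
  move=> entE; have entE' : entourage (rf_near E) by exists E.
  have [[U V] /= [PU PV] UV] := cP _ entE'.
  have [F [UF VF]] := filter_ex (filterI PU PV).
  have [A FA AE] := rf_cauchy F entE.
  exists A => // D entD ED; apply: filterS PV => G VG.
  have [A1 [B1 [FA1 GB1 AB1]]] := UV (F, G) (conj UF VG).
  have [a [Aa A1a]] := filter_ex (filterI FA FA1).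
  by exists B1 => // b B1b; exists a => //; apply/ED/AB1.
pose L : set_system X := [set A | exists2 E, entourage E &
  exists2 A0, (\forall G \near P, rf_sets G A0) &
    forall x y, A0 x -> E (x, y) -> A y].
have LP A : L A -> \forall G \near P, rf_sets G A.
  move=> [E entE [A0 PA0 A0A]]; apply: filterS PA0 => G; apply: filterS => x A0x.
  by apply: A0A A0x _; exact: entourage_refl.
have L_proper : ProperFilter L.
  split.
    move=> /LP P0; have [G G0] := filter_ex P0.
    by have [] := filter_ex G0.
  split.
  - by exists setT; [exact: entourageT|exists setT => //; apply: nearW => G; exact: filterT].
  - move=> A B [E entE [A0 PA0 A0A]] [D entD [B0 PB0 B0B]].
    exists (E `&` D); first exact: filterI.
    exists (A0 `&` B0).
      by apply: filterS (filterI PA0 PB0) => G [? ?]; exact: filterI.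
    by move=> x y [Ax Bx] [Exy Dxy]; split; [exact: A0A Exy|exact: B0B Dxy].
  - move=> A B AB [E entE [A0 PA0 A0A]]; exists E => //; exists A0 => // x y.
    by move=> A0x Exy; apply: AB; exact: A0A Exy.
have L_small E : entourage E -> exists2 A, L A & forall x y, A x -> A y -> E (x, y).
  move=> /ent_pow4[D /ent_pow4[C entC [Csym C4]] [Dsym D4]].
  have [A AC PA] := small C entC.
  have CD x y : C (x, y) -> D (x, y).
    by move=> xy; apply: (C4 _ y y y) => //; exact: entourage_refl.
  exists [set y | exists a b, [/\ A a, C (a, b) & C (b, y)]].
    exists C => //; exists [set b | exists2 a, A a & C (a, b)].
      apply: filterS (PA C entC (fun _ => id)) => G [B GB BA].
      exact: filterS GB.
    by move=> x y [a Aa ax] xy; exists a, x.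
  move=> x y [a [b [Aa ab bx]]] [a' [b' [Aa' ab' by']]].
  have xa : D (x, a).
    by apply: (C4 _ b a a); [exact: Csym|exact: Csym|exact: entourage_refl..].
  have ay : D (a', y).
    by apply: (C4 _ b' y y) => //; exact: entourage_refl.
  apply: (D4 _ a a' y) => //; first by apply/CD/AC.
  apply: (C4 _ y y y); exact: entourage_refl.
have L_round A : L A -> exists2 B, L B &
    exists2 E, entourage E & forall x y, B x -> E (x, y) -> A y.
  move=> [E entE [A0 PA0 A0A]].
  exists [set y | exists2 x, A0 x & split_ent E (x, y)].
    by exists (split_ent E) => //; exists A0 => // x y ? ?; exists x.
  exists (split_ent E) => // x y [a A0a ax] xy; apply: A0A A0a _.
  exact: (entourage_split x).
exists (RoundFilter L_proper L_small L_round).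
apply/cvg_entourageP => W [E entE EW].
have [A LA AE] := L_small E entE.
by apply: filterS (LP _ LA) => G GA; apply: EW; exists A, A.
Qed.

Let rf_nbhsP E : entourage E -> exists2 D, entourage D &
  forall x y, D (x, y) -> rf_near E (rf_nbhs x, rf_nbhs y).
Proof.
move=> /ent_pow4[D entD [Dsym D4]]; exists D => // x y xy.
exists (xsection D x), (xsection D y); split; try exact: nbhs_entourage.
move=> a b /xsectionP xa /xsectionP yb.
by apply: (D4 _ x y b) => //; [exact: Dsym|exact: entourage_refl].
Qed.

Let rf_nearP E x y : rf_near E (rf_nbhs x, rf_nbhs y) -> E (x, y).
Proof.
by move=> [A [B [/nbhs_singleton Ax /nbhs_singleton By AB]]]; exact: AB.
Qed.

Let rf_dense : dense (range rf_nbhs).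
Proof.
move=> O [F OF] openO; have /nbhsP[W [E entE sub] EO] :=
  open_nbhs_nbhs (conj openO OF).
have [D entD [Dsym D4]] := ent_pow4 entE.
have [A FA AD] := rf_cauchy F entD.
have [x Ax] := filter_ex FA.
exists (rf_nbhs x); split; last by exists x.
apply/EO/xsectionP/sub; exists A, (xsection D x); split=> //.
  exact: nbhs_entourage.
move=> a b Aa /xsectionP xb; apply: (D4 _ x b b) => //; first exact: AD.
all: exact: entourage_refl.
Qed.

Lemma completion_exists : hausdorff_space X ->
  exists (Xb : uniformType) (j : X -> Xb), completion j.
Proof.
move=> hX; exists round_filter, rf_nbhs; split=> //.
have inj : injective rf_nbhs.
  move=> x y xy; apply: hX => A B xA yB.
  have: rf_sets (rf_nbhs x) (A `&` B) by apply: filterI => //; rewrite xy.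
  exact: filter_ex.
split=> //.
- move=> /= W [E /rf_nbhsP[D entD DE] sub].
  by apply: filterS entD => -[x y] /= /DE/sub.
- pose g (z : range rf_nbhs) : X := projT1 (cid2 (set_valP z)).
  have gK z : rf_nbhs (g z) = \val z.
    by rewrite /g; case: cid2.
  exists g => // E entE; exists (rf_near E); first by exists E.
  by move=> [z w] zw; apply: rf_nearP; rewrite !gK; exact: zw.
Qed.

End CompletionExists.

(* Main.v *)
Require Import Defs.
From HB Require Import structures.
From mathcomp Require Import all_boot all_order all_algebra.
From mathcomp Require Import all_classical all_reals topology urysohn.
From mathcomp Require Import lra.

Set Implicit Arguments.
Unset Strict Implicit.
Unset Printing Implicit Defensive.

Import Order.TTheory GRing.Theory Num.Theory.
Import numFieldTopology.Exports.

Local Open Scope classical_set_scope.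
Local Open Scope ring_scope.

(** Both halves are proved at once, with a proposition [full] saying whether the
    retractions are to be defined everywhere or on some uniform neighborhood.

    From [X] to its completion.  Let [Z] be an arbitrary uniform space with a
    uniform embedding [k : X -> Z].  By metrization there is a uniformly
    continuous pseudometric [rho] on [Z] whose trace on [k X] induces the
    uniformity of [X].  In [Z * [0, 1]], with the pseudometric
    [rho (z, z') + |t - t'|], remove from the bottom [t = 0] the points outside
    [k X]: in the metric quotient of what remains, the bottom is a copy of [X],
    and it is closed, being the zero set of the height.  As [X] is a uniform
    A(N)R there is a uniformly continuous retraction onto it.  Near the bottom
    the part removed is in the closure of what remains, so by completeness the
    retraction extends to a uniformly continuous [Phi : M * [0, 1] -> Xb], for
    some uniform neighborhood [M] of [k X], after a change of scale in the height
    ([retract_collar]).  Heights [t > 0] were never removed, so there [Phi] takes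
    its values in [X].
    With [Z := Xb] [Phi] is a homotopy witnessing homotopy completeness.
    With [Z] any space containing [Xb], and [k] the restriction of the inclusion
    to [X], the map [Phi (-, 0)] is the identity on [X], hence on [Xb], and is the
    required retraction.  Since [Z] need not be metrizable, this gives the
    universal property of an A(N)RU.

    From the completion to [X].  If [X] is closed in a metrizable [Z], then [Xb]
    embeds in the completion of [Z], which provides a retraction [r] onto [Xb],
    defined on [Z] or on a uniform neighborhood of [X] in it.  With [H] a homotopy
    as in the definition of homotopy completeness and [tau] the distance to [X]
    truncated at 1, the map [z |-> H (r z, tau z)] sends every point into [X]:
    off [X] because [tau z > 0] there, and on [X] because it is the identity
    ([completion_retract_nbhd_retract]). *)

(** * Uniform continuity in terms of entourages *)

Lemma unif_continuous_entourageP (U V : uniformType) (f : U -> V) :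
  unif_continuous f <->
  forall E, entourage E -> exists2 D, entourage D &
    forall x y, D (x, y) -> E (f x, f y).
Proof.
split=> [fu E entE|fu E /fu[D entD DE]].
  by exists [set xy | E (f xy.1, f xy.2)] => //; exact: fu entE.
by apply: filterS entD => -[x y] /= /DE.
Qed.

Lemma entourage_symcomp3 (U : uniformType) (E : set (U * U)) : entourage E ->
  exists2 D, entourage D & (forall x y, D (x, y) -> D (y, x)) /\
    forall a b c d, D (a, b) -> D (b, c) -> D (c, d) -> E (a, d).
Proof.
move=> entE; pose D := split_ent (split_ent E).
have entD : entourage D by do 2! apply: entourage_split_ent.
exists (D `&` D^-1)%relation; first exact: entourage_invI.
split=> [x y [] //|a b c d [ab _] [bc _] [cd _]].
apply: (entourage_split c) => //; first exact: (entourage_split b).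
by apply: split_ent_subset cd; exact: entourage_split_ent.
Qed.

Definition subpoint (T : Type) (A : set T) (x : T) (Ax : A x) : A :=
  exist _ x (mem_set Ax).

Lemma entourage_set_typeP (Z : uniformType) (A : set Z) (E : set (A * A)) :
  entourage E <-> exists2 D, entourage D &
    forall x y : A, D (\val x, \val y) -> E (x, y).
Proof.
split.
  by move=> [D entD DE]; exists D => // x y xy; apply: DE.
by move=> [D entD DE]; exists D => // -[x y] /DE.
Qed.

Lemma entourage_prodP (U V : uniformType) (E : set ((U * V) * (U * V))) :
  entourage E <-> exists2 D1, entourage D1 & exists2 D2, entourage D2 &
    forall x y u v, D1 (x, y) -> D2 (u, v) -> E ((x, u), (y, v)).
Proof.
split.
  move=> [[D1 D2] /= [ent1 ent2] DE]; exists D1 => //; exists D2 => // x y u v xy uv.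
  by have [[[? ?] [? ?]] /= ? [<- <- <- <-]] := DE ((x, y), (u, v)) (conj xy uv).
move=> [D1 ent1 [D2 ent2 DE]]; exists (D1, D2) => // -[[x y] [u v]] [/= xy uv].
by exists ((x, u), (y, v)) => //; exact: DE.
Qed.

Lemma entourage_realP (R : realType) (E : set (R * R)) :
  entourage E <-> exists2 e : R, 0 < e & forall x y, `|x - y| < e -> E (x, y).
Proof.
rewrite -entourage_ballE; split=> -[e e0 eE]; exists e => //=.
  by move=> x y xy; apply: eE.
by move=> [x y] /= xy; apply: eE.
Qed.

Lemma hausdorff_entourage (U : uniformType) (x y : U) : hausdorff_space U ->
  (forall E, entourage E -> E (x, y)) -> x = y.
Proof.
move=> hU xy; apply: hU => A B /nbhsP[D entD DA] /nbhs_singleton By.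
by exists y; split=> //; apply/DA/xsectionP; exact: xy.
Qed.

(** The uniformity of the domain is coarser than the one induced from the
    codomain. *)
Definition reflects_entourages (U V : uniformType) (f : U -> V) :=
  forall E, entourage E -> exists2 D, entourage D &
    forall x y, D (f x, f y) -> E (x, y).

Lemma unif_continuous_comp (U V W : uniformType) (f : U -> V) (g : V -> W) :
  unif_continuous f -> unif_continuous g -> unif_continuous (g \o f).
Proof. by move=> uf ug E /ug/uf. Qed.

Lemma reflects_entourages_comp (U V W : uniformType) (f : U -> V) (g : V -> W) :
  reflects_entourages f -> reflects_entourages g -> reflects_entourages (g \o f).
Proof.
by move=> rf rg E /rf[B /rg[C entC CB] BE]; exists C => // x y /CB/BE.
Qed.

Lemma uniform_embeddingP (U V : uniformType) (i : U -> V) :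
  uniform_embedding i <->
  [/\ injective i, unif_continuous i & reflects_entourages i].
Proof.
split=> -[inji ui].
  move=> [g /unif_continuous_entourageP ug gi]; split=> // E /ug[D].
  move=> /entourage_set_typeP[C entC CD DE]; exists C => // x y xy.
  have im u : range i (i u) by exists u.
  have gK u : g (subpoint (im u)) = u by apply: inji; rewrite gi.
  by rewrite -(gK x) -(gK y); apply/DE/CD.
move=> ri; split=> //.
pose g (z : range i) : U := projT1 (cid2 (set_valP z)).
have gK z : i (g z) = \val z by rewrite /g; case: cid2.
exists g => //; apply/unif_continuous_entourageP => E /ri[D entD DE].
exists [set xy | D (\val xy.1, \val xy.2)]; last first.
  by move=> x y /= xy; apply: DE; rewrite !gK.
by apply/entourage_set_typeP; exists D.
Qed.

(** * Extension from dense subspaces *)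

Lemma dense_entourage (S : Type) (W : uniformType) (e : S -> W) :
  dense (range e) -> forall D w, entourage D -> exists s, D (w, e s).
Proof.
move=> de D w /(open_nbhs_entourage w)[oD Dw].
have [v [/interior_subset/xsectionP wv [s _ sv]]] := de _ (ex_intro _ w Dw) oD.
by exists s; rewrite sv.
Qed.

Lemma unif_continuous_dense_eq (S : Type) (W Y : uniformType) (e : S -> W)
    (g h : W -> Y) :
  hausdorff_space Y -> (forall D w, entourage D -> exists s, D (w, e s)) ->
  unif_continuous g -> unif_continuous h ->
  (forall s, g (e s) = h (e s)) -> g =1 h.
Proof.
move=> hY de /unif_continuous_entourageP ug /unif_continuous_entourageP uh gh w.
apply: hausdorff_entourage => // E /entourage_symcomp3[C entC [Csym C3]].
have [D1 ent1 D1C] := ug _ entC; have [D2 ent2 D2C] := uh _ entC.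
have [s [ws1 ws2]] := de _ w (filterI ent1 ent2).
apply: (C3 _ (g (e s)) (h w)); [exact: D1C| |exact: entourage_refl].
by rewrite gh; apply/Csym/D2C.
Qed.

(** The traces of neighborhood filters on a dense subset are mapped to Cauchy
    filters, whose limits define the extension.  The domain [S] is a bare type
    and uniform continuity of [f] is measured by the entourages of [W] along
    [e], so that [S] may be any dependent pair type over [W]. *)
Lemma unif_continuous_extension (S : Type) (W Y : uniformType) (e : S -> W)
    (f : S -> Y) :
  hausdorff_space Y -> complete_space Y ->
  (forall D w, entourage D -> exists s, D (w, e s)) ->
  (forall E, entourage E -> exists2 D, entourage D &
    forall s t, D (e s, e t) -> E (f s, f t)) ->
  exists2 g : W -> Y, unif_continuous g & forall s, g (e s) = f s.
Proof.
move=> hY cY de uf.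
(* The image under [f] of the trace of the neighborhood filter of [w]. *)
pose F w := filter_from (@entourage W) (fun D => f @` [set s | D (w, e s)]).
have FF w : ProperFilter (F w).
  apply: filter_from_proper; last first.
    by move=> D entD; have [s ws] := de D w entD; exists (f s), s.
  apply: filter_from_filter; first by exists setT; exact: entourageT.
  move=> A B entA entB; exists (A `&` B); first exact: filterI.
  by move=> _ [s [sA sB] <-]; split; exists s.
have cF w : cauchy (F w).
  move=> E /uf[D /entourage_symcomp3[C entC [Csym C3]] DE].
  exists (f @` [set s | C (w, e s)], f @` [set s | C (w, e s)]).
    by split; exists C.
  move=> [_ _] [/= [s ws <-] [t wt <-]]; apply: DE.
  by apply: (C3 _ w (e t)); [exact: Csym|by []|exact: entourage_refl].
have [g gF] := choice (fun w => cY _ (FF w) (cF w)).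
have near_g w E : entourage E -> exists2 D, entourage D &
    forall s, D (w, e s) -> E (g w, f s).
  move=> entE; have [D entD DE] := cvg_entourage (gF w) entE.
  by exists D => // s ws; apply: DE; exists s.
exists g.
  apply/unif_continuous_entourageP => E /entourage_symcomp3[B entB [Bsym B3]].
  have [D /entourage_symcomp3[C entC [Csym C3]] DB] := uf _ entB.
  exists C => // w v wv.
  have [Dw entw Dwg] := near_g w _ entB; have [Dv entv Dvg] := near_g v _ entB.
  have [s [ws Cws]] := de _ w (filterI entw entC).
  have [t [vt Cvt]] := de _ v (filterI entv entC).
  apply: (B3 _ (f s) (f t)); [exact: Dwg| |exact/Bsym/Dvg].
  by apply: DB; apply: (C3 _ w v) => //; exact: Csym.
move=> s; apply: hausdorff_entourage => // E /(near_g (e s))[D entD]; apply.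
exact: entourage_refl.
Qed.

(** * Retractions of uniform neighborhoods *)

(** Stars of covers and sections of entourages define the same uniform
    neighborhoods: the star of a cover by [D]-sections is controlled by
    [D^-1; D], and a cover refined by [E]-sections has a star containing the
    [E]-neighborhood. *)
Lemma uniform_nbhdP (Z : uniformType) (S N : set Z) :
  uniform_nbhd S N <-> exists2 D, entourage D &
    forall s z, S s -> D (s, z) -> N z.
Proof.
split=> [[U [E entE EU] UN]|[E /entourage_symcomp3[D entD [Dsym D3]] EN]].
  exists E => // s z Ss sz; apply: UN; have [A UA EA] := EU s.
  exists A; last exact/EA/xsectionP.
  by split=> //; exists s; split=> //; apply/EA/xsectionP; exact: entourage_refl.
exists [set A | exists z, A = xsection D z].
  by exists D => // z; exists (xsection D z) => //; exists z.
move=> w [_ [[z ->] [s [/xsectionP zs Ss]]] /xsectionP zw]; apply: (EN s) => //.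
by apply: (D3 _ z w) => //; [exact: Dsym|exact: entourage_refl].
Qed.

(** The proposition [full] selects between the two halves of the theorem:
    [True] asks for a retraction of the whole space, which is a uniform
    neighborhood of any subset, and [False] for one of some uniform neighborhood. *)
Definition nbhd_retract (full : Prop) (Z : uniformType) (A : set Z) :=
  exists N, [/\ uniform_nbhd A N, full -> N = setT & uniform_retract A N].

Lemma nbhd_retract_full (Z : uniformType) (A : set Z) :
  nbhd_retract True A <-> uniform_retract A setT.
Proof.
split=> [[N [_ /(_ I) -> ]]//|rA]; exists setT; split=> //.
by apply/uniform_nbhdP; exists setT => //; exact: entourageT.
Qed.

Lemma nbhd_retract_nbhd (Z : uniformType) (A : set Z) :
  nbhd_retract False A <-> exists2 N, uniform_nbhd A N & uniform_retract A N.
Proof. by split=> [[N [? _ ?]]|[N ? ?]]; exists N. Qed.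

(** Composing with the inverse of [i] on its range turns a retraction onto
    [range i] into a map to [Y], which avoids the subspace [range i] altogether. *)
Lemma nbhd_retractP full (Y Z : uniformType) (i : Y -> Z) :
  uniform_embedding i ->
  nbhd_retract full (range i) <-> exists (N : set Z) (r : N -> Y),
    [/\ exists2 D, entourage D & forall y z, D (i y, z) -> N z,
        full -> N = setT,
        unif_continuous r &
        forall (a : N) y, \val a = i y -> r a = y].
Proof.
move=> /uniform_embeddingP[inji ui ri]; split.
  move=> [N [/uniform_nbhdP[D entD DN] fN [AN [r [ur rE]]]]].
  pose g (z : range i) : Y := projT1 (cid2 (set_valP z)).
  have gK z : i (g z) = \val z by rewrite /g; case: cid2.
  exists N, (g \o r); split=> //.
  - by exists D => // y z; apply: DN; exists y.
  - apply/unif_continuous_entourageP => E /ri[C entC CE].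
    have entC' : entourage [set xy : range i * range i | C (\val xy.1, \val xy.2)].
      by apply/entourage_set_typeP; exists C.
    have [B entB BC] := iffLR (unif_continuous_entourageP _) ur _ entC'.
    by exists B => // a b /BC /= ab; apply: CE; rewrite !gK.
  - by move=> a y ay; apply: inji; rewrite gK rE ay//; exists y.
move=> [N [r [[D entD DN] fN /unif_continuous_entourageP ur rE]]]; exists N; split=> //.
  by apply/uniform_nbhdP; exists D => // _ z [y _ <-]; exact: DN.
split; first by move=> _ [y _ <-]; apply: (DN y); exact: entourage_refl.
have im x : range i (i x) by exists x.
exists (fun a => subpoint (im (r a))); split; last first.
  by move=> a [y _ ya] /=; rewrite (rE a y).
apply/unif_continuous_entourageP => E /entourage_set_typeP[C entC CE].
have [B entB BC] := iffLR (unif_continuous_entourageP _) ui _ entC.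
by have [A entA AB] := ur _ entB; exists A => // a b /AB/BC ab; apply: CE.
Qed.

(** * Pseudometrics from sequences of entourages *)

Definition pseudometric (R : realType) (T : Type) (d : T -> T -> R) :=
  [/\ forall x, d x x = 0, forall x y, d x y = d y x &
      forall y x z, d x z <= d x y + d y z].

Lemma pseudometric_ge0 (R : realType) (T : Type) (d : T -> T -> R) x y :
  pseudometric d -> 0 <= d x y.
Proof. by move=> [d0 dC dT]; have := dT y x x; rewrite d0 (dC y x); lra. Qed.

(** A sequence of entourages of [Z] generates a coarser uniformity with a
    countable base; the base below satisfies
    [generator n.+1; generator n.+1 `<=` generator n]. *)
Section CountablyGenerated.
Variables (Z : uniformType) (V : nat -> set (Z * Z)).
Hypothesis entV : forall n, entourage (V n).

(** An alias of [Z]: the proof argument lets the new uniform structure be inferred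
    without interfering with the one of [Z]. *)
Definition countably_generated of (forall n, entourage (V n)) : Type := Z.

Local Notation T := (countably_generated entV).

HB.instance Definition _ := Choice.on T.

Fixpoint generator n : set (T * T) :=
  if n is m.+1 then
    let E := split_ent (generator m : set (Z * Z)) `&` V m in
    (E `&` E^-1)%relation
  else setT.

Let ent_generator n : @entourage Z (generator n).
Proof.
elim: n => [|n IHn]; first exact: entourageT.
by apply: entourage_invI; apply: filterI => //; exact: entourage_split_ent.
Qed.

Let generatorS n : generator n.+1 `<=` generator n.
Proof.
by move=> [x y] [[+ _] _]; apply: (split_ent_subset (ent_generator n)).
Qed.

Let generator_le m n : (m <= n)%N -> generator n `<=` generator m.
Proof.
move=> /subnK <-; elim: (n - m)%N => //= k IHk.
by apply: subset_trans IHk; exact: generatorS.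
Qed.

Let ent : set_system (T * T) := filter_from setT generator.

Let ent_filter : Filter ent.
Proof.
apply: filter_from_filter; first by exists 0%N.
move=> m n _ _; exists (maxn m n) => // xy xym; split.
  exact: generator_le (leq_maxl m n) _ xym.
exact: generator_le (leq_maxr m n) _ xym.
Qed.

Let ent_diag A : ent A -> diagonal `<=` A.
Proof.
move=> [n _ nA] [x y] /diagonalP <-; apply: nA.
exact: (@entourage_refl Z _ x (ent_generator n)).
Qed.

Let ent_inv A : ent A -> ent (A^-1)%relation.
Proof.
move=> [n _ nA]; exists n => // -[x y] xy; apply: nA.
by case: n xy => //= n [? ?].
Qed.

Let ent_split A : ent A -> exists2 B, ent B & (B \; B `<=` A)%relation.
Proof.
move=> [n _ nA]; exists (generator n.+1); first by exists n.+1.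
move=> [x y] [z [[xz _] _] [[zy _] _]]; apply: nA.
exact: (@entourage_split Z z x y _ (ent_generator n) xz zy).
Qed.

HB.instance Definition _ := isUniform.Build T ent_filter ent_diag ent_inv ent_split.

Lemma countably_generated_countable : countable_uniformity T.
Proof.
apply/countable_uniformityP; exists generator.
  by move=> A [n _ nA]; exists n.
by move=> n; exists n.
Qed.

Lemma countably_generated_entourage (A : set (T * T)) :
  @entourage T A -> @entourage Z A.
Proof.
move=> [n _ nA].
exact: (@filterS _ _ (@entourage_filter' Z) _ _ nA (ent_generator n)).
Qed.

Lemma countably_generated_generators n : @entourage T (V n).
Proof. by exists n.+1 => // -[x y] [[_ Vxy] _]. Qed.

End CountablyGenerated.

(** The bound on the balls makes the extended distance finite; its value 2 is the
    one provided by the metrization of countable uniformities. *)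
Lemma pseudometric_edist (R : realType) (M : pseudoMetricType R) :
  (forall x y : M, ball x (2 : R) y) ->
  exists d : M -> M -> R, pseudometric d /\ forall e, 0 < e ->
    (forall x y, d x y < e -> ball x e y) /\
    (forall x y, ball x e y -> d x y <= e).
Proof.
move=> bounded; have fin (x y : M) : edist (x, y) \is a fin_num.
  by apply/edist_finP; exists 2 => //; exact: (bounded x y).
exists (fun x y : M => fine (edist (x, y))); split.
  split=> [x|x y|y x z]; first by rewrite edist_refl.
    by rewrite edist_sym.
  by rewrite -lee_fin EFinD !fineK// edist_triangle.
move=> e e0; split=> x y.
  by rewrite -lte_fin fineK// => /edist_lt_ball.
by move=> xy; rewrite -lee_fin fineK//; exact: edist_fin.
Qed.

(** The metrization theorem for uniformities with a countable base, applied to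
    the uniformity generated by [V], which is coarser than that of [Z]. *)
Lemma pseudometric_of_entourages (R : realType) (Z : uniformType)
    (V : nat -> set (Z * Z)) :
  (forall n, entourage (V n)) ->
  exists d : Z -> Z -> R, [/\ pseudometric d,
    forall e, 0 < e -> entourage [set xy | d xy.1 xy.2 < e] &
    forall n, exists2 e, 0 < e & forall x y, d x y < e -> V n (x, y)].
Proof.
move=> entV.
pose M : pseudoMetricType R :=
  countable_uniform (countably_generated_countable entV).
have [d [dP dB]] := @pseudometric_edist R M
  (@countable_uniform.countable_uniform_bounded R _
    (countably_generated_countable entV)).
exists d; split=> // [e e0|n].
  apply: (@countably_generated_entourage Z V entV).
  have e2 : 0 < e / 2 by rewrite divr_gt0.
  suff : @entourage M [set xy | d xy.1 xy.2 < e] by [].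
  rewrite -entourage_ballE; exists (e / 2) => //= -[x y] /= xy.
  by have := (dB _ e2).2 _ _ xy; lra.
have : @entourage M (V n : set (M * M)).
  exact: (@countably_generated_generators Z V entV n).
rewrite -entourage_ballE => -[e /= e0 eV]; exists e => // x y xy.
by apply: eV; exact: (dB _ e0).1.
Qed.

(** * The metric quotient of a pseudometric *)

(** The quotient by the relation [d x y = 0], realized on the set of chosen
    representatives of its classes. *)
Section MetricQuotient.
Variables (R : realType) (T : choiceType) (d : T -> T -> R).
Hypothesis dP : pseudometric d.

Definition representative x := choose (fun y => d x y == 0) x.

Let d_rep x : d x (representative x) = 0.
Proof.
have [d0 _ _] := dP.
by apply/eqP/(@chooseP _ (fun y => d x y == 0)); rewrite d0.
Qed.

Let rep_eq x y : d x y = 0 -> representative x = representative y.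
Proof.
have [d0 dC dT] := dP.
move=> xy; have dxy z : d x z = d y z.
  by have := dT y x z; have := dT x y z; rewrite (dC y x) xy; lra.
rewrite /representative (eq_choose (Q := fun z => d y z == 0)); last first.
  by move=> z; rewrite dxy.
by apply: choose_id; rewrite ?d0 // dC xy.
Qed.

Let d_rep2 x y : d (representative x) (representative y) = d x y.
Proof.
have [d0 dC dT] := dP; have xr := d_rep x; have yr := d_rep y.
have := dT x (representative x) (representative y).
have := dT y x (representative y).
have := dT (representative x) x y.
have := dT (representative y) (representative x) y.
by rewrite (dC (representative x) x) (dC (representative y) y) xr yr; lra.
Qed.

(** The proof that [d] is a pseudometric is an argument of the type, so that the
    metric structure below can be attached to it. *)
Definition metric_quotient of pseudometric d : Type :=
  {x : T | representative x == x}.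

Local Notation Q := (metric_quotient dP).

HB.instance Definition _ := Choice.on Q.

Definition quotient_dist (x y : Q) : R := d (\val x) (\val y).

Let quotient_dist_eq0 x y : quotient_dist x y = 0 -> x = y.
Proof.
move=> /rep_eq xy; apply/val_inj.
by rewrite /= -(eqP (valP x)) -(eqP (valP y)).
Qed.

HB.instance Definition _ := @isMetric.Build R Q quotient_dist
  (fun x => let: And3 p _ _ := dP in p (\val x))
  quotient_dist_eq0
  (fun x y => let: And3 _ p _ := dP in p (\val x) (\val y))
  (fun y x z => let: And3 _ _ p := dP in p (\val y) (\val x) (\val z)).

Lemma metric_quotientP : exists (U : uniformType) (q : T -> U) (dU : U -> U -> R),
  [/\ forall x, dU x x = 0,
      forall x y, dU x y = 0 -> x = y,
      forall x y, dU x y = dU y x,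
      forall y x z, dU x z <= dU x y + dU y z
    & @entourage U = entourage_ (fun x e => [set y | dU x y < e])] /\
  (forall u, exists x, q x = u) /\ forall x y, dU (q x) (q y) = d x y.
Proof.
have [d0 dC dT] := dP.
have qP x : representative (representative x) == representative x.
  by apply/eqP/esym/rep_eq/d_rep.
exists Q, (fun x => exist _ (representative x) (qP x)), quotient_dist; split.
  split=> [x|x y /quotient_dist_eq0//|x y|y x z|].
  - exact: d0.
  - exact: dC.
  - exact: dT.
  - by [].
split; last by move=> x y; rewrite /quotient_dist d_rep2.
by move=> u; exists (\val u); apply/val_inj => /=; exact/eqP/(valP u).
Qed.

End MetricQuotient.

(** * Collars: from a space to its completion *)

Lemma entourage_metricP (R : realType) (U : uniformType) (d : U -> U -> R) :
  @entourage U = entourage_ (fun x e => [set y | d x y < e]) ->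
  forall E : set (U * U), entourage E <->
    exists2 e, 0 < e & forall x y, d x y < e -> E (x, y).
Proof.
move=> -> E; split=> -[e e0 eE]; exists e => //.
  by move=> x y xy; apply: (eE (x, y)).
by move=> [x y] /= xy; exact: eE.
Qed.

Lemma entourage_unitP (R : realType)
    (E : set (`[0%R, 1%R : R]%classic * `[0%R, 1%R : R]%classic)) :
  entourage E <-> exists2 e : R, 0 < e &
    forall s t : `[0%R, 1%R : R]%classic, `|\val s - \val t| < e -> E (s, t).
Proof.
rewrite entourage_set_typeP; split.
  move=> [D /entourage_realP[e e0 eD] DE]; exists e => // s t st.
  exact/DE/eD.
move=> [e e0 eE]; exists [set xy | `|xy.1 - xy.2| < e]; last exact: eE.
by apply/entourage_realP; exists e.
Qed.

Lemma unit_bounds (R : realType) (t : `[0%R, 1%R : R]%classic) :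
  0 <= \val t <= 1.
Proof. by have := set_valP t; rewrite /= in_itv. Qed.

(** A pseudometric on [Z] inducing the uniformity of the metrizable subspace [X]:
    for each [n] choose an entourage [V n] of [Z] whose trace on [X] lies in the
    [n.+1%:R^-1]-entourage of its metric. *)
Lemma metrizable_pseudometric (R : realType) (X Z : uniformType) (k : X -> Z) :
  metrizable R X -> reflects_entourages k ->
  exists rho : Z -> Z -> R, [/\ pseudometric rho,
    forall e, 0 < e -> entourage [set zw | rho zw.1 zw.2 < e] &
    forall E, entourage E -> exists2 e, 0 < e &
      forall x y, rho (k x) (k y) < e -> E (x, y)].
Proof.
move=> [d [_ _ _ _ entX]] rk.
have /choice[V VP] (n : nat) : exists D : set (Z * Z),
    entourage D /\ forall x y, D (k x, k y) -> d x y < n.+1%:R^-1.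
  have [|D entD DE] := rk [set xy | d xy.1 xy.2 < n.+1%:R^-1]; last by exists D.
  by apply/(entourage_metricP entX); exists n.+1%:R^-1; rewrite // invr_gt0 ltr0n.
have [rho [rhoP urho rhoV]] :=
  pseudometric_of_entourages R (fun n => (VP n).1).
exists rho; split=> // E /(entourage_metricP entX)[e /ltr_add_invr[n]].
rewrite add0r => ne eE; have [e' e'0 e'V] := rhoV n; exists e' => // x y.
by move=> /e'V/(VP n).2 xy; apply/eE/(lt_trans xy ne).
Qed.

(** The main construction: [X] is the closed bottom of the metric quotient [Q] of
    the punctured cylinder over [Z], and the retraction onto it given by the
    hypothesis extends over the punctures because [Y], which stands for the
    completion of [X], is complete. *)
Lemma retract_collar (R : realType) (full : Prop) (X Y Z : uniformType)
    (j : X -> Y) (k : X -> Z) :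
  metrizable R X ->
  (forall (Q : uniformType) (i : X -> Q), metrizable R Q ->
     uniform_embedding i -> closed (range i) -> nbhd_retract full (range i)) ->
  hausdorff_space Y -> complete_space Y -> unif_continuous j ->
  unif_continuous k -> reflects_entourages k ->
  exists (M : set Z) (Phi : (M * `[0%R, 1%R : R]%classic)%type -> Y),
    [/\ exists2 D, entourage D & forall x z, D (k x, z) -> M z,
        full -> M = setT,
        unif_continuous Phi,
        forall a t x, \val a = k x -> \val t = 0 -> Phi (a, t) = j x
      & forall a t, 0 < \val t -> range j (Phi (a, t))].
Proof.
move=> mX retrX hY cY /unif_continuous_entourageP uj.
move=> /unif_continuous_entourageP uk rk.
have [rho [rhoP urho rho_k]] := metrizable_pseudometric mX rk.
have [rho0 rhoC rhoT] := rhoP.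
have rho_ge0 z w : 0 <= rho z w by exact: pseudometric_ge0.
(* The cylinder [Z * [0, 1]] without the points of its bottom outside [k X]. *)
pose A := [set zt : Z * R | 0 <= zt.2 <= 1 /\ (zt.2 = 0 -> range k zt.1)].
pose delta (a b : A) := rho (\val a).1 (\val b).1 + `|(\val a).2 - (\val b).2|.
have deltaP : pseudometric delta.
  split=> [a|a b|b a c]; rewrite /delta.
  - by rewrite rho0 subrr normr0 addr0.
  - by rewrite rhoC distrC.
  - have := rhoT (\val b).1 (\val a).1 (\val c).1.
    by have := ler_distD (\val b).2 (\val a).2 (\val c).2; lra.
have [Q [q [dQ [[dQ0 dQpos dQC dQT entQ] [qsurj qd]]]]] := metric_quotientP deltaP.
have kA x : A (k x, 0) by split; [rewrite /= lexx ler01|move=> _; exists x].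
pose i x := q (subpoint (kA x)).
have di x y : dQ (i x) (i y) = rho (k x) (k y).
  by rewrite qd /delta /= subrr normr0 addr0.
have embi : uniform_embedding i.
  apply/uniform_embeddingP; split.
  - move=> x y xy; apply: (hausdorff_entourage (metrizable_hausdorff mX)).
    by move=> E /rho_k[e e0]; apply; rewrite -di xy dQ0.
  - apply/unif_continuous_entourageP => E /(entourage_metricP entQ)[e e0 eE].
    have [D entD De] := uk _ (urho e e0).
    by exists D => // x y /De/= xy; apply: eE; rewrite di.
  - move=> E /rho_k[e e0 eE].
    exists [set xy | dQ xy.1 xy.2 < e]; last by move=> x y /=; rewrite di => /eE.
    by apply/(entourage_metricP entQ); exists e.
(* A point at distance 0 from the bottom has height 0, so it lies over [k X]. *)
have cli : closed (range i).
  move=> u; have [[[z t] zt] <-] := qsurj u => clu.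
  have [/= t01 tk] := set_mem zt.
  have t0 : t = 0.
    apply/eqP; rewrite eq_le (andP t01).1 andbT; apply/ler_addgt0Pl => e e0.
    have entB : entourage [set uv : Q * Q | dQ uv.1 uv.2 < e].
      by apply/(entourage_metricP entQ); exists e.
    have [_ [[x _ <-] /xsectionP]] := clu _ (nbhs_entourage _ entB).
    rewrite /= /i qd /delta /= subr0 addr0 => ?.
    by have := ler_norm t; have := rho_ge0 z (k x); lra.
  have [x _ kx] := tk t0; exists x => //.
  by congr q; apply: val_inj; rewrite /= kx t0.
have [|N [r [[D /(entourage_metricP entQ)[e0 e00 e0D] DN] fN]]] :=
  (nbhd_retractP full embi).1 (retrX _ _ _ embi cli); first by exists dQ.
move=> /unif_continuous_entourageP ur ri.
(* A point over [M] of height at most [e / 4] is at distance less than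
   [e / 2 + e / 4] from the bottom, hence in [N]; the bound [e <= 1] makes the
   contraction [t |-> e / 4 * t] map the unit interval into itself. *)
have [e [e_gt0 ee0 e1]] : exists e, [/\ 0 < e, e <= e0 & e <= 1].
  by exists (Num.min e0 1); rewrite lt_min e00 ltr01 !ge_min !lexx orbT.
(* [W] is the collar and [S] the part of it that was not removed. *)
pose M := [set z | full \/ exists x, rho (k x) z < e / 2].
pose W := (M * `[0%R, 1%R : R]%classic)%type.
pose S := {w : W | \val w.2 = 0 -> range k (\val w.1)}.
have SA (s : S) : A (\val (sval s).1, e / 4 * \val (sval s).2).
  case: s => -[z t] /= tk; have /= /andP[t0 t1] := unit_bounds t.
  split=> /=; first by apply/andP; split; nra.
  by move=> te; apply: tk; nra.
have SN (s : S) : N (q (subpoint (SA s))).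
  have [] := set_valP (sval s).1; first by move/fN => ->.
  move=> [x xs]; apply: (DN x); apply: e0D.
  have /= /andP[t0 t1] := unit_bounds (sval s).2.
  rewrite /i qd /delta /= sub0r normrN ger0_norm; nra.
pose f (s : S) := j (r (subpoint (SN s))).
(* The bottom is approximated by small positive heights over the same point. *)
have dense_S D0 w : entourage D0 -> exists s : S, D0 (w, sval s).
  move=> entD; have [t0|t0] := eqVneq (\val w.2) 0; last first.
    have wS : \val w.2 = 0 -> range k (\val w.1) by move/eqP: t0.
    by exists (exist _ w wS); exact: entourage_refl.
  have [D1 ent1 [D2 /entourage_unitP[e' e'0 e'D] DD]] :=
    (entourage_prodP _).1 entD.
  pose t := Num.min (e' / 2) 1.
  have tpos : 0 < t by rewrite lt_min ltr01 andbT; lra.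
  have te : t <= e' / 2 by rewrite ge_min lexx.
  have t1 : t <= 1 by rewrite ge_min lexx orbT.
  have t01 : `[0%R, 1%R : R]%classic t by rewrite /= in_itv /= (ltW tpos).
  pose t' := subpoint t01.
  have wS : \val t' = 0 -> range k (\val w.1).
    by move=> /= tz; move: tpos; rewrite tz ltxx.
  exists (exist _ (w.1, t') wS) => /=.
  rewrite [w]surjective_pairing; apply: DD; first exact: entourage_refl.
  apply: e'D; rewrite t0 /= sub0r normrN ger0_norm; lra.
have uf E : entourage E -> exists2 D, entourage D &
    forall s t : S, D (sval s, sval t) -> E (f s, f t).
  move=> /uj[B /ur[C /entourage_set_typeP[C' entC' C'C] CB] BE].
  have [a a0 aC] := (entourage_metricP entQ _).1 entC'.
  have a20 : 0 < a / 2 by rewrite divr_gt0.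
  pose D1 := [set xy : M * M | rho (\val xy.1) (\val xy.2) < a / 2].
  pose D2 := [set xy : `[0%R, 1%R : R]%classic * `[0%R, 1%R : R]%classic |
    `|\val xy.1 - \val xy.2| < a / 2].
  exists [set vw | D1 (vw.1.1, vw.2.1) /\ D2 (vw.1.2, vw.2.2)].
    apply/entourage_prodP; exists D1.
      apply/entourage_set_typeP.
      by exists [set xy | rho xy.1 xy.2 < a / 2]; first exact: urho.
    by exists D2 => //; apply/entourage_unitP; exists (a / 2).
  move=> s t [/= st1 st2]; apply/BE/CB/C'C/aC; rewrite /= qd /delta /=.
  rewrite -mulrBr normrM gtr0_norm ?divr_gt0//.
  rewrite /D1 /= in st1; rewrite /D2 /= in st2.
  have := normr_ge0 (\val (sval s).2 - \val (sval t).2).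
  by move: st1 st2; set u := `|_|; set v := rho _ _ => *; nra.
have [Phi uPhi PhiE] := unif_continuous_extension hY cY dense_S uf.
exists M, Phi; split=> //.
- exists [set zw | rho zw.1 zw.2 < e / 2]; first by apply: urho; lra.
  by move=> x z /= xz; right; exists x.
- by move=> fu; apply/seteqP; split=> // z _; left.
- move=> a t x ax t0.
  have aS : \val (a, t).2 = 0 -> range k (\val (a, t).1) by move=> _; exists x.
  rewrite -[(a, t)]/(sval (exist _ _ aS : S)) PhiE; congr j; apply: ri.
  by rewrite /= /i; congr q; apply: val_inj; rewrite /= t0 mulr0 ax.
- move=> a t t0.
  have aS : \val (a, t).2 = 0 -> range k (\val (a, t).1).
    by move=> /= tz; move: t0 => /=; rewrite tz ltxx.
  rewrite -[(a, t)]/(sval (exist _ _ aS : S)) PhiE.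
  by exists (r (subpoint (SN (exist _ _ aS)))).
Qed.

Section FromUniformRetract.
Variables (R : realType) (full : Prop) (X Xb : uniformType) (j : X -> Xb).
Hypotheses (hX : metrizable R X) (hj : completion j).
Hypothesis retrX : forall (Z : uniformType) (i : X -> Z), metrizable R Z ->
  uniform_embedding i -> closed (range i) -> nbhd_retract full (range i).

(** The collar of [X] in its completion; by density the neighborhood [M] of [X] is
    the whole completion. *)
Lemma retract_homotopy_complete : homotopy_complete R j.
Proof.
have [hXb cXb /uniform_embeddingP[_ uj rj] /dense_entourage dj] := hj.
have [M [Phi [[D entD DM] _ uPhi Phi0 Phi1]]] :=
  retract_collar hX retrX hXb cXb uj uj rj.
have Mx x : M x.
  by have [a xa] := dj _ x (entourage_inv entD); exact: DM xa.
pose H (p : (Xb * `[0%R, 1%R : R]%classic)%type) := Phi (subpoint (Mx p.1), p.2).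
have uH : unif_continuous H.
  apply/unif_continuous_entourageP => E entE.
  have [B /entourage_prodP[D1 ent1 [D2 ent2 DB]] BE] :=
    (unif_continuous_entourageP _).1 uPhi _ entE.
  have [D1' ent1' D1D] := (entourage_set_typeP _).1 ent1.
  exists [set pq | D1' (pq.1.1, pq.2.1) /\ D2 (pq.1.2, pq.2.2)].
    by apply/entourage_prodP; exists D1' => //; exists D2.
  by move=> [x s] [y t] [/= xy st]; apply/BE/DB => //; exact: D1D.
exists H; split=> // [x t t0|x t]; last exact: Phi1.
apply: (unif_continuous_dense_eq (g := fun y => H (y, t)) (h := id) hXb dj).
- apply/unif_continuous_entourageP => E entE.
  have [B /entourage_prodP[D1 ent1 [D2 ent2 DB]] BE] :=
    (unif_continuous_entourageP _).1 uH _ entE.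
  exists D1 => // y z yz; apply/BE/DB => //; exact: entourage_refl.
- by apply/unif_continuous_entourageP => E entE; exists E.
- by move=> s; exact: Phi0.
Qed.

(** The bottom of the collar of [X] in [Z]: a uniform neighborhood of [X] is one of
    [Xb] by density, and a map that is the identity on [X] is so on [Xb]. *)
Lemma completion_nbhd_retract (Z : uniformType) (i : Xb -> Z) :
  uniform_embedding i -> nbhd_retract full (range i).
Proof.
have [hXb cXb /uniform_embeddingP[_ uj rj] /dense_entourage dj] := hj.
move=> embi; have [_ ui ri] := (uniform_embeddingP _).1 embi.
have [M [Phi [[D entD DM] fM uPhi Phi0 _]]] := retract_collar hX retrX hXb cXb
  uj (unif_continuous_comp uj ui) (reflects_entourages_comp rj ri).
have t0 : `[0%R, 1%R : R]%classic 0 by rewrite /= in_itv /= lexx ler01.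
pose z0 := subpoint t0.
have [D' entD' [D'sym D'3]] := entourage_symcomp3 entD.
have [B entB BD'] := (unif_continuous_entourageP _).1 ui _ entD'.
have DMb x z : D' (i x, z) -> M z.
  move=> xz; have [a xa] := dj _ x entB; apply: (DM a).
  by apply: (D'3 _ (i x) z) => //; [exact/D'sym/BD'|exact: entourage_refl].
apply/(nbhd_retractP full embi); exists M, (fun a => Phi (a, z0)).
have uPhi0 : unif_continuous (fun a => Phi (a, z0)).
  apply/unif_continuous_entourageP => E entE.
  have [F /entourage_prodP[D1 ent1 [D2 ent2 DF]] FE] :=
    (unif_continuous_entourageP _).1 uPhi _ entE.
  by exists D1 => // y z yz; apply/FE/DF => //; exact: entourage_refl.
split=> //; first by exists D'.
move=> a x ax.
have Mi y : M (i y) by apply: (DMb y); exact: entourage_refl.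
have -> : a = subpoint (Mi x) by apply: val_inj.
apply: (unif_continuous_dense_eq
  (g := fun y => Phi (subpoint (Mi y), z0)) (h := id) hXb dj).
- apply/unif_continuous_entourageP => E entE.
  have [F /entourage_set_typeP[G entG GF] FE] :=
    (unif_continuous_entourageP _).1 uPhi0 _ entE.
  have [K entK KG] := (unif_continuous_entourageP _).1 ui _ entG.
  by exists K => // y z /KG yz; apply/FE/GF.
- by apply/unif_continuous_entourageP => E entE; exists E.
- by move=> s; exact: Phi0.
Qed.

End FromUniformRetract.

(** * From the completion back to the space *)

(** Writing the distance as a supremum of lower bounds in [[0, 1]] truncates it and
    gives it the value 1 when [A] is empty. *)
Lemma truncated_distance (R : realType) (T : Type) (d : T -> T -> R) (A : set T) :
  pseudometric d -> exists tau : T -> R,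
    [/\ forall z, 0 <= tau z <= 1,
        forall z w, `|tau z - tau w| <= d z w,
        forall z, A z -> tau z = 0
      & forall z, tau z = 0 -> forall e, 0 < e -> exists2 a, A a & d z a < e].
Proof.
move=> dP; have [d0 dC dT] := dP.
pose B z := [set s : R | 0 <= s <= 1 /\ forall a, A a -> s <= d z a].
have B0 z : B z 0.
  by split=> [|a _]; [rewrite lexx ler01|exact: pseudometric_ge0].
have ubB z : ubound (B z) 1 by move=> s [/andP[]].
have hsB z : has_ubound (B z) by exists 1.
have tauB z s : B z s -> s <= sup (B z) by exact: ub_le_sup.
have supB z u : ubound (B z) u -> sup (B z) <= u by apply: ge_sup; exists 0.
have lip z w : sup (B z) <= sup (B w) + d z w.
  apply: supB => s [s01 sz].
  have dzw : 0 <= d z w := pseudometric_ge0 z w dP.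
  have [sd|sd] := leP s (d z w).
    by have := tauB w 0 (B0 w); lra.
  suff : s - d z w <= sup (B w) by lra.
  apply: tauB; split; first by lra.
  by move=> a /sz; have := dT w z a; lra.
exists (fun z => sup (B z)); split.
- by move=> z; rewrite tauB //= supB.
- move=> z w; rewrite ler_norml; have := lip z w; have := lip w z.
  by rewrite (dC w z) => *; apply/andP; split; lra.
- move=> z Az; apply/eqP; rewrite eq_le tauB // andbT; apply: supB => s [_ sA].
  by rewrite -(d0 z) sA.
- move=> z z0 e e0; apply: contrapT => nA.
  have : Num.min e 1 <= sup (B z).
    apply: tauB; split.
      by rewrite le_min (ltW e0) ler01 ge_min lexx orbT.
    move=> a Aa; rewrite ge_min; apply/orP; left; rewrite leNgt; apply/negP => za.
    by apply: nA; exists a.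
  by rewrite z0 leNgt lt_min e0 ltr01.
Qed.

Lemma closed_metric (R : realType) (Z : uniformType) (d : Z -> Z -> R)
    (A : set Z) (z : Z) :
  @entourage Z = entourage_ (fun x e => [set y | d x y < e]) -> closed A ->
  (forall e, 0 < e -> exists2 a, A a & d z a < e) -> A z.
Proof.
move=> entZ clA zA; apply: clA => B /nbhsP[E].
move=> /(entourage_metricP entZ)[e e0 eE] EB; have [a Aa za] := zA e e0.
by exists a; split=> //; apply/EB/xsectionP/eE.
Qed.

(** Entourages are tested on a dense subspace: move both points to nearby points
    of [X]. *)
Lemma extension_reflects (X Xb Zb : uniformType) (j : X -> Xb) (g : Xb -> Zb) :
  (forall D x, entourage D -> exists a, D (x, j a)) ->
  unif_continuous j -> unif_continuous g -> reflects_entourages (g \o j) ->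
  reflects_entourages g.
Proof.
move=> dj /unif_continuous_entourageP uj /unif_continuous_entourageP ug rgj.
move=> E /entourage_symcomp3[B entB [Bsym B3]].
have [A /rgj[D' /entourage_symcomp3[D entD [Dsym D3]] D'A] AB] := uj _ entB.
have [C entC CD] := ug _ entD; exists D => // x y xy.
have [a [Bxa Cxa]] := dj _ x (filterI entB entC).
have [b [Byb Cyb]] := dj _ y (filterI entB entC).
apply: (B3 _ (j a) (j b)) => //; last exact: Bsym.
by apply/AB/D'A; apply: (D3 _ (g x) (g y)) => //; [exact/Dsym/CD|exact: CD].
Qed.

(** The retraction is [z |-> H (r z, tau z)], where [r] is a retraction onto the
    copy of [Xb] in the completion [Zb] of [Z], embedded there by the extension
    [ib] of the inclusion of [X], and [tau] is the truncated distance to [X]. *)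
Lemma completion_retract_nbhd_retract (R : realType) (full : Prop)
    (X Xb : uniformType) (j : X -> Xb) :
  completion j -> homotopy_complete R j ->
  (forall (Z : uniformType) (i : Xb -> Z), hausdorff_space Z ->
     uniform_embedding i -> nbhd_retract full (range i)) ->
  forall (Z : uniformType) (i : X -> Z), metrizable R Z ->
    uniform_embedding i -> closed (range i) -> nbhd_retract full (range i).
Proof.
move=> [hXb cXb /uniform_embeddingP[injj uj rj] /dense_entourage dj].
move=> [H [/unif_continuous_entourageP uH H0 H1]] retrXb Z i mZ embi cli.
have [_ ui ri] := (uniform_embeddingP _).1 embi.
have [Zb [jz [hZb cZb /uniform_embeddingP[_ ujz rjz] _]]] :=
  completion_exists (metrizable_hausdorff mZ).
have [|ib uib ibE] := unif_continuous_extension (f := jz \o i) hZb cZb dj.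
  move=> E /((unif_continuous_entourageP _).1 (unif_continuous_comp ui ujz))[B].
  by move=> /rj[D entD DB] BE; exists D => // s t /DB/BE.
have rib : reflects_entourages ib.
  apply: (extension_reflects dj uj uib).
  by have -> : ib \o j = jz \o i; [exact: funext|exact: reflects_entourages_comp].
have embib : uniform_embedding ib.
  apply/uniform_embeddingP; split=> // x y xy.
  apply: hausdorff_entourage => // E /rib[D entD]; apply.
  by rewrite xy; exact: entourage_refl.
have [N [r [[D entD DN] fN /unif_continuous_entourageP ur rE]]] :=
  (nbhd_retractP full embib).1 (retrXb _ _ hZb embib).
have [d [d0 _ dC dT entZ]] := mZ.
have [tau [tau01 tau_lip tauA tau0]] :=
  @truncated_distance R Z d (range i) (And3 d0 dC dT).
pose M := jz @^-1` N.
have NM (a : M) : N (jz (\val a)) by exact: (set_valP a).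
have tauI z : `[0%R, 1%R : R]%classic (tau z).
  by rewrite /= in_itv; exact: tau01.
pose h (a : M) := H (r (subpoint (NM a)), subpoint (tauI (\val a))).
have h_i (a : M) x : \val a = i x -> h a = j x.
  move=> ax; rewrite /h H0; last by apply: tauA; exists x.
  by apply: rE; rewrite /= ibE /= -ax.
have h_j a : range j (h a).
  have [ta|ta] := eqVneq (tau (\val a)) 0; last first.
    by apply: H1; rewrite lt_neqAle eq_sym ta; case/andP: (tau01 (\val a)).
  have [x _ xa] := closed_metric entZ cli (tau0 _ ta).
  by exists x => //; rewrite (h_i _ x).
pose g (a : M) : X := projT1 (cid2 (h_j a)).
have gK a : j (g a) = h a by rewrite /g; case: cid2.
apply/(nbhd_retractP full embi); exists M, g; split.
- have [D' entD' D'D] := (unif_continuous_entourageP _).1 ujz _ entD.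
  by exists D' => // x z /D'D xz; apply: (DN (j x)); rewrite ibE.
- by move=> fu; rewrite /M fN // preimage_setT.
- apply/unif_continuous_entourageP => E /rj[A /uH[B /entourage_prodP[D1]]].
  move=> /ur[F /entourage_set_typeP[G]].
  move=> /((unif_continuous_entourageP _).1 ujz)[K entK KG] GF FD1.
  move=> [D2 /entourage_unitP[e e0 eD2] DB] BA AE.
  have ente : entourage [set zw | d zw.1 zw.2 < e].
    by apply/(entourage_metricP entZ); exists e.
  exists [set ab : M * M | (K `&` [set zw | d zw.1 zw.2 < e]) (\val ab.1, \val ab.2)].
    by apply/entourage_set_typeP; eexists; first exact: filterI entK ente.
  move=> a b [Kab dab]; apply: AE; rewrite !gK; apply/BA/DB.
    by apply/FD1/GF/KG.
  by apply: eD2; exact: le_lt_trans (tau_lip _ _) dab.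
- by move=> a x /h_i ax; apply: injj; rewrite gK.
Qed.

(** * The characterization *)

Theorem theorem13p3 (R : realType) (X : uniformType) (hX : metrizable R X)
    (Xb : uniformType) (j : X -> Xb) (hj : completion j) :
  (uniform_AR R X <-> homotopy_complete R j /\ ARU Xb) /\
  (uniform_ANR R X <-> homotopy_complete R j /\ ANRU Xb).
Proof.
have [hXb _ _ _] := hj; split; split.
- move=> [_ AR].
  have retrX (Z : uniformType) (i : X -> Z) : metrizable R Z -> uniform_embedding i ->
      closed (range i) -> nbhd_retract True (range i).
    by move=> mZ ei cli; apply/nbhd_retract_full/AR.
  split; first exact: (retract_homotopy_complete hX hj retrX).
  split=> // Z i _ ei; apply/nbhd_retract_full.
  exact: (completion_nbhd_retract hX hj retrX).
- move=> [hc [_ ARUXb]]; split=> // Z i mZ ei cli; apply/nbhd_retract_full.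
  apply: (completion_retract_nbhd_retract hj hc _ mZ ei cli) => T k hT ek.
  exact/nbhd_retract_full/ARUXb.
- move=> [_ ANR].
  have retrX (Z : uniformType) (i : X -> Z) : metrizable R Z -> uniform_embedding i ->
      closed (range i) -> nbhd_retract False (range i).
    by move=> mZ ei cli; apply/nbhd_retract_nbhd/ANR.
  split; first exact: (retract_homotopy_complete hX hj retrX).
  split=> // Z i _ ei; apply/nbhd_retract_nbhd.
  exact: (completion_nbhd_retract hX hj retrX).
- move=> [hc [_ ANRUXb]]; split=> // Z i mZ ei cli; apply/nbhd_retract_nbhd.
  apply: (completion_retract_nbhd_retract hj hc _ mZ ei cli) => T k hT ek.
  exact/nbhd_retract_nbhd/ANRUXb.
Qed.
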